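(* Let $(X,\tau)$ be a $T_2$ (Hausdorff) topological space. The following statements are equivalent: (a) for every integer $n>1$, $Sel^c_n(X)\neq\emptyset$; (b) for every prime $p$, $Sel^c_p(X)\neq\emptyset$.
   Context: For a Hausdorff space $(X,\tau)$, $\mathcal{F}(X)$ is the set of nonempty closed subsets of $X$, with the Vietoris topology: the topology generated by the sets $\langle\mathcal{V}\rangle=\{A\in\mathcal{F}(X) : A\subseteq\bigcup\mathcal{V}\text{ and } A\cap V\neq\emptyset\text{ for all }V\in\mathcal{V}\}$, where $\mathcal{V}$ is a finite subset of $\tau$. $[X]^n$ is the set of subsets of $X$ of cardinality exactly $n$, with the subspace topology. $Sel^c_n(X)$ is the set of continuous selections on $[X]^n$, i.e. continuous functions $f:[X]^n\to X$ with $f(A)\in A$ for all $A\in[X]^n$. *)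

(* Defs.v *)
From HB Require Import structures.
From mathcomp Require Import all_boot all_order all_algebra.
From mathcomp Require Import all_classical all_reals topology.

Set Implicit Arguments.
Unset Strict Implicit.
Unset Printing Implicit Defensive.

Local Open Scope classical_set_scope.
Local Open Scope card_scope.

Definition nonempty_closed (X : topologicalType) : set (set X) :=
  [set A | A !=set0 /\ closed A].
Arguments nonempty_closed X : clear implicits.

Definition hyperspace (X : topologicalType) : Type :=
  set_type (nonempty_closed X).

HB.instance Definition _ (X : topologicalType) := Choice.on (hyperspace X).

Definition hset (X : topologicalType) (A : hyperspace X) : set X := \val A.

Definition finite_open_family (X : topologicalType) : set (set (set X)) :=
  [set VV | finite_set VV /\ forall V, VV V -> open V].

Definition vietoris (X : topologicalType) (VV : set (set X)) :
    set (hyperspace X) :=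
  [set A | hset A `<=` \bigcup_(V in VV) V /\
           forall V, VV V -> hset A `&` V !=set0].

HB.instance Definition _ (X : topologicalType) :=
  isSubBaseTopological.Build (hyperspace X)
    (@finite_open_family X) (@vietoris X).

Definition nsubsets (X : topologicalType) (n : nat) : set (hyperspace X) :=
  [set A | hset A #= `I_n].
Arguments nsubsets X n : clear implicits.

(* As a type, [nsubsets X n] carries the subspace topology that the library
   puts on [set_type]. Restricting to closed sets loses nothing when X is
   Hausdorff and n > 0. *)
Lemma nsubsets_full (X : topologicalType) (n : nat) (B : set X) :
  hausdorff_space X -> (0 < n)%N -> B #= `I_n ->
  exists2 A : hyperspace X, nsubsets X n A & hset A = B.
Proof.
move=> hX n0 Bn.
have fB : finite_set B by exists n.
have B0 : B !=set0.
  apply/set0P/negP => /eqP B0; move: Bn; rewrite B0 => /card_esym.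
  by rewrite card_eq0 => /eqP/seteqP[/(_ 0%N) + _]; exact.
have cB : closed B.
  by move/hausdorff_accessible/accessible_finite_set_closed : hX; exact.
have AB : B \in nonempty_closed X by exact: mem_set.
by exists (exist _ B AB).
Qed.

Definition continuous_selections (X : topologicalType) (n : nat) :
    set (nsubsets X n -> X) :=
  [set f | continuous f /\
           forall A : nsubsets X n, hset (\val A) (f A)].
Arguments continuous_selections X n : clear implicits.

(* Main.v *)
Require Import Defs.
From mathcomp Require Import all_boot all_order all_algebra.
From mathcomp Require Import all_classical all_reals topology.
From mathcomp Require Import finmap zify.

(** Only the construction of selections for composite [n] from those for
    primes needs an argument. Let [A] have [n > 1] points, let [p] be the least
    prime divisor of [n], and let [f] be a continuous selection on the
    [p]-element sets. The [p]-element subsets of [A] vote: each [B] gives its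
    vote to the point [f B]. There are ['C(n, p)] votes, and [n] does not divide
    ['C(n, p)] when [p] is a prime divisor of [n] ([ndvd_bin_prime_dvd]), so
    the points of [A] cannot all get the same number of votes. The points with
    the most votes thus form a nonempty proper subset of [A]
    ([winners_proper]). Repeating this with that subset in place of [A], whose
    cardinality selects the next prime, leaves a single point after at most
    [n - 1] rounds; that point is the value of the selection at [A].

    Continuity comes from a discrete description of continuous selections. In a
    Hausdorff space the finite sets near [A] with as many points as [A] are the
    images [phi @` A] of [A] under the maps [phi : X -> X] that move every
    point very little ([vietoris_near_id] and [near_id_vietoris]). A selection
    [f] is continuous exactly when [f (phi @` A) = phi (f A)] for all [phi]
    close enough to the identity: the points of [A] have disjoint
    neighborhoods, so a value which moves continuously has to follow the point
    that it selects ([selector_of_selection] and [selection_of_selector]).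
    Commutation with all [phi] near the identity is plainly inherited by
    anything that is defined from [A] by counting, such as the set of winners,
    and by iteration, because finitely many conditions on [phi] can be imposed
    at once. *)

Set Implicit Arguments.
Unset Strict Implicit.
Unset Printing Implicit Defensive.

Local Open Scope classical_set_scope.

(** * Binomial coefficients and subsets of a given cardinality *)

(** Since [p * 'C(n, p) = n * 'C(n.-1, p.-1)], divisibility by [n] would make
    [p] divide ['C(n.-1, p.-1)], hence [(n - 1) * ... * (n - p + 1)]; but these
    factors are congruent to [-1, ..., -(p - 1)] modulo [p]. *)
Lemma ndvd_bin_prime_dvd (n p : nat) : prime p -> (0 < n)%N -> (p %| n)%N ->
  ~~ (n %| 'C(n, p))%N.
Proof.
move=> pp n0 pn; have p0 := prime_gt0 pp; have lepn := dvdn_leq n0 pn.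
have npC : ~~ (p %| 'C(n.-1, p.-1))%N.
  apply/negP => pC; have : (p %| n.-1 ^_ p.-1)%N by rewrite -bin_ffact dvdn_mulr.
  rewrite ffact_prod; elim/big_ind: _ => [|a b ha hb|i _].
  - by rewrite dvdn1; case/eqP=> p1; rewrite p1 in pp.
  - by rewrite Euclid_dvdM// => /orP[/ha|/hb].
  have ip : (i.+1 < p)%N by rewrite -ltn_predRL.
  rewrite -subn1 -subnDA add1n dvdn_subr//; last exact: leq_trans (ltnW ip) lepn.
  by rewrite gtnNdvd.
apply: contra npC => /dvdnP[c Cc].
have := mul_bin_diag n p.-1; rewrite prednK// Cc mulnA [RHS]mulnC => /eqP.
by rewrite eqn_pmul2l// => /eqP ->; rewrite dvdn_mulr.
Qed.

Lemma sum_fpowerset_card (X : choiceType) (A : {fset X}) (p : nat) :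
  (\sum_(B <- fpowerset A | #|` B| == p) 1 = 'C(#|` A|, p))%N.
Proof.
rewrite big_mkcond big_imfset/=; last first.
  by move=> U V _ _ /fsetP UV; apply/setP => x; have := UV (val x); rewrite !inE.
rewrite -big_mkcond/= big_enum_cond/= sum1dep_card cardfE -card_draws.
apply: eq_card => U; rewrite !inE/= finset.subsetT card_imfset/=; last exact: val_inj.
by rewrite -cardE.
Qed.

(** * Voting *)

(** A rule that picks one point of a set is encoded as a map [s] from finite
    sets to finite sets whose value is a singleton. This needs no default point
    of [X], which may be empty, and makes picking a point, passing to the
    winners and iterating maps of the same type. *)
Section votes.
Variables (X : choiceType) (s : {fset X} -> {fset X}).

Definition votes (A : {fset X}) (x : X) : nat :=
  \sum_(B <- fpowerset A | #|` B| == pdiv #|` A|) (s B == [fset x]%fset).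

(** All the points with the maximal number of votes: no choice is made between
    them, so that the set depends on [A] and [s] only. *)
Definition winners (A : {fset X}) : {fset X} :=
  [fset x in A | all (fun y => votes A y <= votes A x)%N A]%fset.

Lemma winnersP (A : {fset X}) (x : X) :
  reflect (x \in A /\ {in A, forall y, (votes A y <= votes A x)%N})
          (x \in winners A).
Proof.
rewrite !inE/=; apply: (iffP andP) => -[xA h]; split => //; first exact/allP.
by apply/allP => y yA; exact: h.
Qed.

Lemma winners_sub (A : {fset X}) : (winners A `<=` A)%fset.
Proof. by apply/fsubsetP => x /winnersP[]. Qed.

Lemma winners_neq0 (A : {fset X}) : A != fset0 -> winners A != fset0.
Proof.
move=> /fset0Pn[x xA].
case: (arg_maxnP (fun y : A => votes A (val y))
  (isT : xpredT [` xA]%fset)) => y _ ymax.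
apply/fset0Pn; exists (val y); apply/winnersP; split; first exact: valP.
by move=> z zA; exact: (ymax [` zA]%fset).
Qed.

(** If every point won, all would have the same number of votes, and [#|` A|]
    would divide the number of voters. *)
Lemma winners_proper (A : {fset X}) : (1 < #|` A|)%N ->
  (forall B : {fset X}, prime #|` B| ->
     exists2 x, x \in B & s B = [fset x]%fset) ->
  (winners A `<` A)%fset.
Proof.
move=> A1 selp; rewrite fproperEneq winners_sub andbT; apply/eqP => wA.
have pp := pdiv_prime A1.
have /negP := ndvd_bin_prime_dvd pp (ltnW A1) (pdiv_dvd _); apply.
have [x xA] : exists x, x \in A by apply/fset0Pn; rewrite -cardfs_gt0 ltnW.
have votes_cst y : y \in A -> votes A y = votes A x.
  move=> yA; have := yA; have := xA; rewrite -{1 2}wA.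
  move=> /winnersP[_ xm] /winnersP[_ ym].
  by apply/eqP; rewrite eqn_leq xm ?ym.
apply/dvdnP; exists (votes A x).
rewrite -sum_fpowerset_card.
transitivity (\sum_(y <- A) votes A y)%N; last first.
  rewrite big_seq (eq_bigr (fun=> votes A x)) => [|y /votes_cst//].
  by rewrite -big_seq big_const_seq count_predT iter_addn_0.
(* Each voter gives exactly one vote, and gives it to a point of [A]. *)
rewrite exchange_big/= big_seq_cond [RHS]big_seq_cond; apply: eq_bigr => B.
rewrite fpowersetE => /andP[BA /eqP Bp].
have [|y yB ->] := selp B; first by rewrite Bp.
rewrite (big_fsetD1 y)/=; last exact: (fsubsetP BA).
rewrite eqxx big_seq big1 ?addn0// => z; rewrite !inE => /andP[zy _].
case: eqP => // /fsetP/(_ y); rewrite !inE eqxx => /esym/eqP yz.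
by rewrite yz eqxx in zy.
Qed.

(** An injection that is compatible with the rule on the subsets of [A]
    transports the whole election. *)
Lemma winners_imfset (A : {fset X}) (phi : X -> X) :
  {in A &, injective phi} ->
  (forall B, (B `<=` A)%fset -> s (phi @` B)%fset = (phi @` s B)%fset) ->
  (forall B, (B `<=` A)%fset -> (s B `<=` B)%fset) ->
  winners (phi @` A)%fset = (phi @` winners A)%fset.
Proof.
move=> inj eqv sub.
have inj_on B : (B `<=` A)%fset -> {in B &, injective phi}.
  by move=> /fsubsetP BA x y /BA xA /BA yA; exact: inj.
have imgK B C : (B `<=` A)%fset -> (C `<=` A)%fset ->
    (phi @` B = phi @` C)%fset -> B = C.
  move=> /fsubsetP BA /fsubsetP CA /fsetP BC; apply/fsetP => x; apply/idP/idP.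
    move=> xB; have := BC (phi x); rewrite in_imfset// => /esym/imfsetP[y /= yC].
    by move=> /inj -> //; [exact: BA|exact: CA].
  move=> xC; have := BC (phi x); rewrite [RHS]in_imfset// => /imfsetP[y /= yC].
  by move=> /inj -> //; [exact: CA|exact: BA].
have cardim B : (B `<=` A)%fset -> #|` (phi @` B)%fset| = #|` B|.
  by move=> BA; rewrite card_in_imfset//; exact: inj_on.
have votesE x : x \in A -> votes (phi @` A)%fset (phi x) = votes A x.
  move=> xA; rewrite /votes cardim//.
  have -> : fpowerset (phi @` A)%fset =
      ((fun B : {fset X} => phi @` B) @` fpowerset A)%fset.
    apply/fsetP => C; rewrite fpowersetE; apply/fsubsetP/imfsetP => /= [CA|[B]].
      exists [fset x in A | phi x \in C]%fset.
        by rewrite fpowersetE; apply/fsubsetP => y; rewrite !inE => /andP[].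
      apply/fsetP => z; apply/idP/imfsetP => /= [zC|[y]].
        have /imfsetP[y /= yA zE] := CA _ zC.
        by exists y; rewrite // !inE yA -zE.
      by rewrite !inE => /andP[_ yC] ->.
    rewrite fpowersetE => /fsubsetP BA -> _ /imfsetP[y /= /BA yA ->].
    exact: in_imfset.
  rewrite big_mkcond big_imfset/=; last first.
    by move=> B C; rewrite !fpowersetE; exact: imgK.
  rewrite -big_mkcond/= big_seq_cond [RHS]big_seq_cond; apply: eq_big => B.
    by rewrite fpowersetE; apply: andb_id2l => BA; rewrite cardim.
  rewrite fpowersetE => /andP[BA _]; rewrite eqv//.
  congr nat_of_bool; apply/eqP/eqP => [sB|->]; last exact: imfset_fset1.
  apply: imgK; rewrite ?fsub1set ?imfset_fset1//.
  by apply: (fsubset_trans _ BA); exact: sub.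
apply/fsetP => z; apply/winnersP/imfsetP => /=.
  move=> [/imfsetP[x /= xA ->] xm]; exists x => //; apply/winnersP; split=> // y yA.
  by rewrite -!votesE//; apply: xm; exact: in_imfset.
move=> [x /winnersP[xA xm] ->]; split; first exact: in_imfset.
by move=> _ /imfsetP[y /= yA ->]; rewrite !votesE//; exact: xm.
Qed.

End votes.
(** * Maps near the identity *)

Section near_id.
Variable X : topologicalType.

(** The neighborhoods of the identity in the box topology. With that topology,
    rather than pointwise convergence, a single family of neighborhoods of the
    points bounds [phi] on every finite set. *)
Definition near_id : set_system (X -> X) :=
  filter_from [set U : X -> set X | forall x, nbhs x (U x)]
              (fun U => [set phi | forall x, U x (phi x)]).

Global Instance near_id_filter : Filter near_id.
Proof.
apply: filter_from_filter => [|U V Un Vn].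
  by exists (fun=> setT) => x; exact: filterT.
by exists (fun x => U x `&` V x) => [x|phi UV]; [exact: filterI|
  split=> x; have [] := UV x].
Qed.

Lemma near_id_nbhs (x : X) (V : set X) : nbhs x V ->
  \forall phi \near near_id, V (phi x).
Proof.
move=> xV; exists (fun y => [set z | y = x -> V z]) => [y|phi]; last exact.
have [->|yx] := pselect (y = x); first by apply: (filterS _ xV) => z Vz _.
by apply: nearW => z /yx.
Qed.

Hypothesis hX : hausdorff_space X.

Lemma separating_nbhs (A : {fset X}) : exists U : X -> set X,
  (forall x, nbhs x (U x)) /\
  (forall x y z, x \in A -> y \in A -> U x z -> U y z -> x = y).
Proof.
have /choice[V VP] : forall p : X * X, exists V : set X * set X,
    [/\ nbhs p.1 V.1, nbhs p.2 V.2 & p.1 != p.2 -> V.1 `&` V.2 = set0].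
  move=> [x y]; have [->|xy] := eqVneq x y.
    by exists (setT, setT); split => /=; rewrite ?eqxx//; exact: filterT.
  move: hX; rewrite open_hausdorff => /(_ _ _ xy)[[V W]/=[xV yW] [oV oW /eqP VW]].
  by exists (V, W); split => //=; apply: open_nbhs_nbhs; split=> //; exact/set_mem.
exists (fun x => \bigcap_(y in [set` A]) ((V (x, y)).1 `&` (V (y, x)).2)); split.
  move=> x; apply: filter_bigI => y _.
  by apply: filterI; [have [] := VP (x, y)|have [] := VP (y, x)].
move=> x y z xA yA /(_ _ yA)[xz _] /(_ _ xA)[_ yz]; apply/eqP/negPn/negP => xy.
have [_ _ /(_ xy)] := VP (x, y) => /seteqP[+ _].
by move=> /(_ z); apply; split.
Qed.

Lemma near_id_inj (A : {fset X}) :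
  \forall phi \near near_id, {in A &, injective phi}.
Proof.
have [U [Un Usep]] := separating_nbhs A.
exists U => // phi Uphi x y xA yA xy.
by apply: (Usep _ _ (phi x)) => //; rewrite xy.
Qed.

(** The discrete form of continuity at [A] of a map that chooses a subset. *)
Definition natural_at (s : {fset X} -> {fset X}) (A : {fset X}) :=
  \forall phi \near near_id, s (phi @` A)%fset = (phi @` s A)%fset.

Lemma natural_winners (s : {fset X} -> {fset X}) :
  (forall B, (s B `<=` B)%fset) -> (forall B, natural_at s B) ->
  forall A, natural_at (winners s) A.
Proof.
move=> sub nat_s A.
have nat_sub : \forall phi \near near_id, forall B, (B `<=` A)%fset ->
    s (phi @` B)%fset = (phi @` s B)%fset.
  have := @filter_bigI _ _ (fpowerset A)
    (fun B phi => s (phi @` B)%fset = (phi @` s B)%fset)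
    _ near_id_filter (fun B _ => nat_s B).
  by apply: filterS => phi H B BA; apply: H; rewrite /= fpowersetE.
near=> phi; apply: winners_imfset => //.
- by near: phi; exact: near_id_inj.
- by near: phi.
Unshelve. all: by end_near. Qed.

Lemma natural_iter (w : {fset X} -> {fset X}) : (forall A, natural_at w A) ->
  forall n A, natural_at (iter n w) A.
Proof.
move=> nat_w; elim=> [|n IH] A; first exact: nearW.
near=> phi; rewrite !iterS.
have -> : iter n w (phi @` A)%fset = (phi @` iter n w A)%fset.
  by near: phi; exact: IH.
by near: phi; exact: nat_w.
Unshelve. all: by end_near. Qed.

(** * The Vietoris topology near a finite set *)

Lemma nbhs_hyperspace (a : hyperspace X) (P : set (hyperspace X)) :
  nbhs a P -> exists F : {fset set (set X)},
    [/\ forall VV, VV \in F -> finite_open_family VV,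
        forall VV, VV \in F -> vietoris VV a &
        forall b, (forall VV, VV \in F -> vietoris VV b) -> P b].
Proof.
rewrite nbhsE => -[O [[D DI <-] [G DG Ga]] OP].
have [F FD FG] := DI _ DG; exists F.
have {}FG : \bigcap_(VV in [set` F]) vietoris VV = G by [].
split=> [VV /FD/set_mem//|VV VVF|b bF].
  by move: Ga; change (G a -> vietoris VV a); rewrite -FG; exact.
by apply: OP; exists G => //; change (G b); rewrite -FG.
Qed.

(** The map [phi |-> phi @` A] is continuous at the identity: membership of
    [phi @` A] in a subbasic set amounts to finitely many conditions, each on
    the value of [phi] at one point of [A]. *)
Lemma vietoris_near_id (A : {fset X}) (a : hyperspace X)
    (P : set (hyperspace X)) :
  hset a = [set` A] -> nbhs a P ->
  \forall phi \near near_id, forall b : hyperspace X,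
    hset b = [set` (phi @` A)%fset] -> P b.
Proof.
move=> aA /nbhs_hyperspace[F [F_open aF FP]].
suff near_F : \forall phi \near near_id, forall VV, VV \in F ->
    forall b : hyperspace X, hset b = [set` (phi @` A)%fset] -> vietoris VV b.
  by apply: filterS near_F => phi H b bA; apply: FP => VV VVF; exact: H.
apply: filter_bigI => VV VVF.
have [VV_fin VV_open] := F_open _ VVF.
have [a_cover a_meet] : vietoris VV a by exact: aF.
have near_cover : \forall phi \near near_id, forall x, x \in A ->
    (\bigcup_(V in VV) V) (phi x).
  apply: filter_bigI => x xA; apply: near_id_nbhs; apply: open_nbhs_nbhs; split.
    exact: bigcup_open.
  by apply: a_cover; rewrite aA.
have near_meet : \forall phi \near near_id, forall V, V \in fset_set VV ->
    ([set` (phi @` A)%fset] `&` V) !=set0.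
  apply: filter_bigI => V; rewrite in_fset_set// => /set_mem VVV.
  have [x [+ Vx]] := a_meet _ VVV; rewrite aA => xA.
  have : \forall phi \near near_id, V (phi x).
    by apply: near_id_nbhs; apply: open_nbhs_nbhs; split=> //; exact: VV_open.
  by apply: filterS => phi Vphi; exists (phi x); split => //; exact: in_imfset.
apply: filterS2 near_cover near_meet => phi phi_cover phi_meet b bA; split.
  by rewrite bA => _ /imfsetP[x /= xA ->]; exact: phi_cover.
by move=> V VVV; rewrite bA; apply: phi_meet; rewrite in_fset_set//; exact: mem_set.
Qed.

Lemma open_vietoris (VV : set (set X)) : finite_open_family VV ->
  open (vietoris VV).
Proof.
move=> fo; exists [set vietoris VV]; last exact: bigcup_set1.
move=> _ ->; exists [fset VV]%fset; last first.
  by rewrite set_fset1 bigcap_set1.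
by move=> W; rewrite inE => /eqP ->; exact/mem_set.
Qed.

(** The map [phi |-> phi @` A] is open at the identity onto the sets with
    [#|` A|] points: such a set which meets each of some disjoint neighborhoods
    of the points of [A] has exactly one point in each of them, and [phi] moves
    the points of [A] to these. *)
Lemma near_id_vietoris (A : {fset X}) (a : hyperspace X) (P : set (X -> X)) :
  hset a = [set` A] -> near_id P ->
  \forall b \near a, forall B : {fset X},
    hset b = [set` B] -> #|` B| = #|` A| ->
    exists2 phi, P phi & B = (phi @` A)%fset.
Proof.
move=> aA [U Un UP]; have [W [Wn Wsep]] := separating_nbhs A.
pose V x := (U x `&` W x)°.
have Vx x : V x x by apply: nbhs_singleton; apply: nbhs_interior; exact: filterI.
have fo : finite_open_family (V @` [set` A]).
  by split; [exact/finite_image/finite_fset|move=> _ [x _ <-]; exact: open_interior].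
have : nbhs a (vietoris (V @` [set` A])).
  apply: open_nbhs_nbhs; split; first exact: open_vietoris.
  rewrite /vietoris /= aA; split.
    by move=> x xA; exists (V x) => //; exists x.
  by move=> _ [x xA <-]; exists x.
apply: filterS => b [_ b_meet] B bB cardB.
have /choice[f fP] x : exists y, x \in A -> y \in B /\ V x y.
  have [xA|] := pselect (x \in A); last by exists x.
  have /b_meet[y [By Vxy]] : (V @` [set` A]) (V x) by exists x.
  by exists y => _; split=> //; move: By; rewrite bB.
pose phi x := if x \in A then f x else x.
have phiE x : x \in A -> phi x = f x by rewrite /phi => ->.
have phiV x : x \in A -> (U x `&` W x) (phi x).
  by move=> xA; apply: interior_subset; rewrite phiE//; have [] := fP _ xA.
exists phi.
  apply: UP => x; have [/phiV[]//|xA] := boolP (x \in A).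
  by rewrite /phi (negbTE xA); exact: nbhs_singleton.
apply/esym/eqP; rewrite eqEfcard cardB card_in_imfset/=.
  rewrite leqnn andbT; apply/fsubsetP => _ /imfsetP[x /= xA ->].
  by rewrite phiE//; have [] := fP _ xA.
move=> x y xA yA xy; apply: (Wsep _ _ (phi x)) => //; first by have [] := phiV _ xA.
by rewrite xy; have [] := phiV _ yA.
Qed.

(** * Continuous selections as selectors *)

Lemma nbhs_set_type (T : topologicalType) (S : set T) (a : S) (P : set S) :
  nbhs a P -> nbhs (\val a) [set t : T | forall b : S, \val b = t -> P b].
Proof.
move=> [_ [[Q oQ <-] Qa QP]].
have : nbhs (\val a) Q by apply: open_nbhs_nbhs; split.
apply: filterS => t Qt b bt.
by apply: QP; rewrite /preimage /= /set_val/= bt.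
Qed.

Definition selector (n : nat) (s : {fset X} -> {fset X}) :=
  forall A : {fset X}, #|` A| = n ->
    natural_at s A /\ exists2 x, x \in A & s A = [fset x]%fset.

(** By continuity [f (phi @` A)] stays in the chosen neighborhood of [f A], and
    [phi (f A)] is the only point of [phi @` A] there. *)
Lemma selector_of_selection (n : nat) : (0 < n)%N ->
  continuous_selections X n !=set0 -> exists s, selector n s.
Proof.
move=> n0 [f [fcont fsel]].
have /choice[s sP] (A : {fset X}) : exists S : {fset X}, #|` A| = n ->
    exists2 a : nsubsets X n, hset (\val a) = [set` A] & S = [fset f a]%fset.
  have [/card_eq_fsetP An|nA] := eqVneq #|` A| n; last first.
    by exists A => An; rewrite An eqxx in nA.
  have [a an aA] := nsubsets_full hX n0 An.
  by exists [fset f (exist _ a (mem_set an))]%fset => _;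
    exists (exist _ a (mem_set an)).
exists s => A An; have [a aA sA] := sP _ An.
have faA : f a \in A by have := fsel a; rewrite aA.
split; last by exists (f a).
have [U [Un Usep]] := separating_nbhs A.
have near_f := vietoris_near_id aA (nbhs_set_type (fcont a _ (Un (f a)))).
near=> phi.
have Uphi : forall y, U y (phi y) by near: phi; exists U.
have phi_inj : {in A &, injective phi} by near: phi; exact: near_id_inj.
have [|b bA ->] := sP (phi @` A)%fset; first by rewrite card_in_imfset.
rewrite sA imfset_fset1.
have : f b \in (phi @` A)%fset by have := fsel b; rewrite bA.
move=> /imfsetP[y /= yA fb]; rewrite fb; congr [fset phi _]%fset.
apply/esym/(Usep _ _ (f b)) => //; last by rewrite fb.
have : forall b : hyperspace X, hset b = [set` (phi @` A)%fset] ->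
    forall c : nsubsets X n, \val c = b -> U (f a) (f c) by near: phi.
by move=> /(_ _ bA b); apply.
Unshelve. all: by end_near. Qed.

Lemma selection_of_selector (n : nat) (s : {fset X} -> {fset X}) :
  selector n s -> continuous_selections X n !=set0.
Proof.
move=> sP.
pose supp (a : nsubsets X n) := fset_set (hset (\val a)).
have suppK (a : nsubsets X n) : hset (\val a) = [set` supp a].
  by rewrite fset_setK//; exists n; exact: (set_mem (valP a)).
have supp_card (a : nsubsets X n) : #|` supp a| = n.
  by apply: card_fset_set; exact: (set_mem (valP a)).
have /choice[f fP] (a : nsubsets X n) :
    exists x, x \in supp a /\ s (supp a) = [fset x]%fset.
  by have [_ [x xa sa]] := sP _ (supp_card a); exists x.
exists f; split=> [a W fW|a]; last by rewrite suppK; have [] := fP a.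
have near_W : near_id [set phi | W (phi (f a)) /\
    s (phi @` supp a)%fset = (phi @` s (supp a))%fset].
  by apply: filterI; [exact: near_id_nbhs|exact: (sP _ (supp_card a)).1].
have cval : {for a, continuous (\val : nsubsets X n -> hyperspace X)}.
  exact: initial_continuous.
have := cval _ (near_id_vietoris (suppK a) near_W).
rewrite nbhs_simpl/=; apply: filterS => b /(_ (supp b) (suppK b)).
rewrite !supp_card => /(_ erefl)[phi [Wphi sphi] ba].
have : [fset f b]%fset = [fset phi (f a)]%fset.
  by rewrite -(fP b).2 ba sphi (fP a).2 imfset_fset1.
by move=> /fset1_inj fb; rewrite /preimage/= fb.
Qed.

(** * From primes to all positive integers *)

Lemma selector_of_prime_selectors :
  (forall p, prime p -> exists s, selector p s) ->
  forall n, (0 < n)%N -> exists s, selector n s.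
Proof.
move=> sel_prime n n0.
have /choice[S SP] p : exists s : {fset X} -> {fset X}, prime p -> selector p s.
  by have [/sel_prime[s]|] := boolP (prime p); [exists s|exists id].
(* One rule for all cardinalities; outside the primes it only has to be
   natural and to have values inside its arguments. *)
pose s (A : {fset X}) := if prime #|` A| then S #|` A| A else A.
have s1 (A : {fset X}) : prime #|` A| ->
    exists2 x, x \in A & s A = [fset x]%fset.
  by move=> pA; rewrite /s pA; have [] := SP _ pA A.
have s_sub A : (s A `<=` A)%fset.
  have [/s1[x xA ->]|pA] := boolP (prime #|` A|); first by rewrite fsub1set.
  by rewrite /s (negbTE pA).
have s_nat A : natural_at s A.
  have near_card : \forall phi \near near_id, #|` (phi @` A)%fset| = #|` A|.
    by apply: filterS (near_id_inj A) => phi inj; rewrite card_in_imfset.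
  have [pA|pA] := boolP (prime #|` A|).
    apply: filterS2 near_card (SP _ pA A erefl).1 => phi cphi.
    by rewrite /s cphi pA.
  by apply: filterS near_card => phi cphi; rewrite /s cphi (negbTE pA).
exists (iter n.-1 (winners s)) => A An; split.
  exact: natural_iter (natural_winners s_sub s_nat) _ _.
(* As long as two points remain, each round removes at least one. *)
have iterP k : [/\ (iter k (winners s) A `<=` A)%fset,
     iter k (winners s) A != fset0 &
     (#|` iter k (winners s) A| <= maxn 1 (n - k))%N].
  elim: k => [|k [IHs IH0 IHn]].
    by rewrite fsubset_refl -cardfs_gt0 An subn0 leq_max leqnn orbT.
  rewrite iterS; split.
  - exact: fsubset_trans (winners_sub _ _) IHs.
  - exact: winners_neq0.
  set B := iter k _ _ in IH0 IHn *; have [B1|B1] := ltnP 1 #|` B|.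
    have := fproper_ltn_card (winners_proper B1 s1); lia.
  apply: leq_trans (fsubset_leq_card (winners_sub _ _)) _; lia.
have [/fsubsetP iA i0 i1] := iterP n.-1.
have /cardfs1P[x ix] : #|` iter n.-1 (winners s) A| == 1%N.
  rewrite eqn_leq cardfs_gt0 i0 andbT; apply: leq_trans i1 _; lia.
by exists x => //; apply: iA; rewrite ix inE.
Qed.
End near_id.

Theorem theorem5 (X : topologicalType) (hX : hausdorff_space X) :
  (forall n : nat, (1 < n)%N -> continuous_selections X n !=set0) <->
  (forall p : nat, prime p -> continuous_selections X p !=set0).
Proof.
split=> [sel p /prime_gt1|sel n n1]; first exact: sel.
have [||s] := @selector_of_prime_selectors X hX _ n.
- by move=> p pp; apply: selector_of_selection => //; [exact: prime_gt0|exact: sel].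
- exact: ltnW.
- exact: selection_of_selector.
Qed.
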